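(* Let $\mathcal U$ be the uniform distribution on the Clifford group $\mathrm{Cl}_n$ and $O=|\phi\rangle\langle\phi|-\mathbb 1/d$ with $|\phi\rangle\in\mathcal H$ a pure state. Then $$V_*(O)<\frac{2^{1-M_2(\phi)/2}(d+1)}{d+2},\qquad V_*(O,\phi)=\frac{2^{1-M_2(\phi)}(d+1)-4}{d+2}<2^{1-M_2(\phi)}.$$
   Context: Let $n\ge1$, $d=2^n$, $\mathcal H=(\mathbb C^2)^{\otimes n}$ with computational basis $\{|\mathbf b\rangle\}$. For a unitary ensemble $\mathcal U$ with measurement channel $\mathcal M(X)=\mathbb E_{U}\sum_{\mathbf b}\langle\mathbf b|UXU^\dagger|\mathbf b\rangle U^\dagger|\mathbf b\rangle\langle\mathbf b|U$ (for a 2-design, $\mathcal M^{-1}(O)=(d+1)O-\operatorname{tr}(O)\mathbb 1$), define for a density operator $\rho$ and traceless Hermitian $O$: $V_*(O,\rho)=\mathbb E_{U}\bigl(\sum_{\mathbf b}\langle\mathbf b|U\rho U^\dagger|\mathbf b\rangle\langle\mathbf b|U\mathcal M^{-1}(O)U^\dagger|\mathbf b\rangle\bigr)^2-[\operatorname{tr}(O\rho)]^2$, $V_*(O)=\max_\rho V_*(O,\rho)$, and $V_*(O,\phi)=V_*(O,|\phi\rangle\langle\phi|)$. $\mathrm{Cl}_n$ is the $n$-qubit Clifford group. With $\overline{\mathcal P}_n=\{I,X,Y,Z\}^{\otimes n}$ and $\Xi_\phi(P)=\langle\phi|P|\phi\rangle$, the stabilizer 2-Rényi entropy of $|\phi\rangle$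 is $M_2(\phi)=-\log_2\bigl(\frac1d\sum_{P\in\overline{\mathcal P}_n}\Xi_\phi(P)^4\bigr)$. *)

(* Defs.v *)
From HB Require Import structures.
From mathcomp Require Import all_boot all_order all_algebra.
From mathcomp Require Import complex.
From mathcomp Require Import all_classical all_reals.
From mathcomp Require Import exp.
Set Implicit Arguments. Unset Strict Implicit. Unset Printing Implicit Defensive.
Import Order.TTheory GRing.Theory Num.Theory.
Local Open Scope ring_scope.
Local Open Scope classical_set_scope.

Section Qubits.
Variable R : realType.
Local Notation C := (complex R).
Variable n : nat.
Local Notation d := (2 ^ n)%N.

Definition dag (m p : nat) (A : 'M[C]_(m, p)) : 'M[C]_(p, m) :=
  (map_mx Num.conj A)^T.

Definition qbit (k i : nat) : bool := odd (i %/ 2 ^ k).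

(* single-qubit Pauli matrices: 0 = I, 1 = X, 2 = Y, 3 = Z; entry <a|sigma|b> *)
Definition pauli1 (s : 'I_4) (a b : bool) : C :=
  match nat_of_ord s with
  | 0 => if a == b then 1 else 0
  | 1 => if a == b then 0 else 1
  | 2 => if a == b then 0 else if b then - 'i else 'i
  | _ => if a == b then (if a then -1 else 1) else 0
  end.

Definition pauli_mx (s : {ffun 'I_n -> 'I_4}) : 'M[C]_d :=
  \matrix_(i, j) \prod_(k < n) pauli1 (s k) (qbit k i) (qbit k j).

Definition clifford (U : 'M[C]_d) : Prop :=
  U *m dag U = 1%:M /\
  forall s, exists t (c : C), c ^+ 4 = 1 /\
    U *m pauli_mx s *m dag U = c *: pauli_mx t.

(* cs is a transversal of Cl_n modulo global phases: every Clifford unitary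
   equals (up to a global phase) exactly one element of cs.  The uniform
   distribution on Cl_n (for phase-invariant quantities) is then the
   uniform average over cs. *)
Definition clifford_transversal (cs : seq 'M[C]_d) : Prop :=
  [/\ forall U, U \in cs -> clifford U,
      uniq cs,
      forall U V, U \in cs -> V \in cs -> (exists c : C, U = c *: V) -> U = V
    & forall U, clifford U -> exists2 V, V \in cs & exists c : C, U = c *: V].

Definition avgU (cs : seq 'M[C]_d) (f : 'M[C]_d -> C) : C :=
  (size cs)%:R^-1 * \sum_(U <- cs) f U.

Definition Mchan (cs : seq 'M[C]_d) (X : 'M[C]_d) : 'M[C]_d :=
  (size cs)%:R^-1 *:
    \sum_(U <- cs) \sum_(b < d)
       ((U *m X *m dag U) b b) *: (dag U *m delta_mx b b *m U).

(* M^{-1}(O): the (unique, M being invertible) preimage of O under M *)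
Definition Minv (cs : seq 'M[C]_d) (O : 'M[C]_d) : 'M[C]_d :=
  xget 0 [set X | Mchan cs X = O].

Definition density (rho : 'M[C]_d) : Prop :=
  [/\ dag rho = rho,
      forall v : 'cV[C]_d, 0 <= (dag v *m rho *m v) 0 0
    & \tr rho = 1].

Definition Vrho (cs : seq 'M[C]_d) (O rho : 'M[C]_d) : R :=
  complex.Re (avgU cs (fun U =>
        (\sum_(b < d) (U *m rho *m dag U) b b * (U *m Minv cs O *m dag U) b b)
          ^+ 2)
      - (\tr (O *m rho)) ^+ 2).

Definition Vstar (cs : seq 'M[C]_d) (O : 'M[C]_d) : R :=
  sup [set Vrho cs O rho | rho in density].

(* Xi_phi(P) = <phi|P|phi>  (real, since P is Hermitian) *)
Definition Xi (phi : 'cV[C]_d) (s : {ffun 'I_n -> 'I_4}) : C :=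
  (dag phi *m pauli_mx s *m phi) 0 0.

Definition log2 (x : R) : R := ln x / ln 2.

Definition M2 (phi : 'cV[C]_d) : R :=
  - log2 ((d%:R : R)^-1 * \sum_(s : {ffun 'I_n -> 'I_4}) (complex.Re (Xi phi s)) ^+ 4).

Definition pure_state (phi : 'cV[C]_d) : Prop := dag phi *m phi = 1.

End Qubits.

(* Main.v *)
(** For a Clifford unitary [U], the signs with which Paulis are mapped to
Paulis cancel in [sum_b <b|UAU^dag|b><b|UBU^dag|b>], which equals
[1/d sum_(s in S_U) tr(A P_s) tr(B P_s)], where [S_U] is the set of Paulis
that [U] maps to Z-type Paulis.  The average over [U] therefore only involves
the probabilities of [s \in S_U] and of [s, t \in S_U].  They are invariant
under the action of the Clifford group on Pauli labels, and symplectic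
transvections act transitively on nontrivial labels and on commuting pairs of
distinct nontrivial labels.  With [#|S_U| = d] this gives
[Pr(s, t \in S_U) = (1 + chi(s,t) + d [s = t]) / ((d+1)(d+2))] for [s, t != 0],
[chi] being the commutation sign, and with [F s = Xi_phi(s) tr(rho P_s)] and
[f = <phi|rho|phi>]
[V(O, rho) = (d+1)/(d^2(d+2)) (d sum_s F_s^2 + sum_(s,t) chi(s,t) F_s F_t)
             - (1+f)^2/(d+2)].
For [rho = |phi><phi|] the double sum is [d sum_s Xi_phi(s)^4].  In general it is
at most [d sum_s F_s^2] by Plancherel, and [sum_s F_s^2] is bounded by
Cauchy-Schwarz, using [sum_s tr(rho P_s)^4 <= sum_s tr(rho P_s)^2 <= d]. *)

Require Import Defs.
From HB Require Import structures.
From mathcomp Require Import all_boot all_order all_algebra.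
From mathcomp Require Import complex.
From mathcomp Require Import all_classical all_reals.
From mathcomp Require Import exp.
From mathcomp Require Import ring lra.
Import Order.TTheory GRing.Theory Num.Theory.
Local Open Scope ring_scope.
Set Implicit Arguments. Unset Strict Implicit. Unset Printing Implicit Defensive.

(** * Binary digits of basis indices *)

Lemma qbitS (k i : nat) : qbit k.+1 i = qbit k i./2.
Proof. by rewrite /qbit expnS divnMA divn2. Qed.

Lemma qbit_inj (n i j : nat) : (i < 2 ^ n)%N -> (j < 2 ^ n)%N ->
  (forall k, (k < n)%N -> qbit k i = qbit k j) -> i = j.
Proof.
elim: n i j => [|n IH] i j; first by case: i; case: j.
rewrite expnS => ltin ltjn eqb; rewrite -(odd_double_half i) -(odd_double_half j).
have := eqb 0%N isT; rewrite /qbit expn0 !divn1 => ->.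
rewrite (IH i./2 j./2) // ?ltn_half_double -?mul2n // => k ltkn.
by rewrite -!qbitS eqb.
Qed.

Definition bits (n : nat) (i : 'I_(2 ^ n)) : {ffun 'I_n -> bool} :=
  [ffun k : 'I_n => qbit k i].

Lemma bits_inj (n : nat) : injective (@bits n).
Proof.
move=> i j eqb; apply/val_inj/(@qbit_inj n) => //= k ltkn.
by have /ffunP/(_ (Ordinal ltkn)) := eqb; rewrite !ffunE.
Qed.

Lemma bits_bij (n : nat) : bijective (@bits n).
Proof.
by apply: inj_card_bij (@bits_inj n) _; rewrite card_ffun card_bool !card_ord.
Qed.

(** Distributivity after reindexing along [bits]; this reduces products and traces of n-qubit Paulis
    to single-qubit computations. *)
Lemma sum_prod_qbit (A : comPzRingType) (n : nat) (g : 'I_n -> bool -> A) :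
  \sum_(i < 2 ^ n) \prod_(k < n) g k (qbit k i) =
  \prod_(k < n) \sum_b g k b.
Proof.
rewrite bigA_distr_bigA (reindex (@bits n)) /=; last exact/onW_bij/bits_bij.
by apply: eq_bigr => i _; apply: eq_bigr => k _; rewrite ffunE.
Qed.

Lemma prod_delta (A : comPzRingType) (I : finType) (P : pred I) :
  \prod_(k : I) (P k)%:R = [forall k, P k]%:R :> A.
Proof.
case: forallP => [allP | /forallP]; first by rewrite big1 // => k _; rewrite allP.
by rewrite negb_forall => /existsP[k /negPf Pk]; rewrite (bigD1 k) //= Pk mul0r.
Qed.

Lemma prod_qbit_eq (A : comPzRingType) (n : nat) (i j : 'I_(2 ^ n)) :
  \prod_(k < n) (qbit k i == qbit k j)%:R = (i == j)%:R :> A.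
Proof.
rewrite prod_delta; congr (nat_of_bool _)%:R; apply/forallP/eqP => [eqb|-> //].
by apply/bits_inj/ffunP => k; rewrite !ffunE; apply/eqP.
Qed.

(* Product of single-qubit Paulis up to phase, for I, X, Y, Z = 0, 1, 2, 3. *)
Definition xor4 (a b : 'I_4) : 'I_4 :=
  Ordinal (ltn_pmod (match val a, val b with
    | 0, y => y | x, 0 => x
    | 1, 1 => 0 | 1, 2 => 3 | 1, _ => 2
    | 2, 1 => 3 | 2, 2 => 0 | 2, _ => 1
    | _, 1 => 2 | _, 2 => 1 | _, _ => 0 end) (isT : 0 < 4)%N).

Definition com4 (a b : 'I_4) : bool := [|| a == ord0, b == ord0 | a == b].

(** Normalising the bound proof to [isT] makes each case a closed ordinal, so that the single-qubit
    tables can be checked by computation. *)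
Lemma ord4_ind (P : 'I_4 -> Prop) :
  P (@Ordinal 4 0 isT) -> P (@Ordinal 4 1 isT) -> P (@Ordinal 4 2 isT) ->
  P (@Ordinal 4 3 isT) -> forall a, P a.
Proof.
move=> P0 P1 P2 P3 [[|[|[|[|//]]]] lta];
  by rewrite (bool_irrelevance lta isT).
Qed.

(** * Single-qubit Pauli matrices *)

Section Single.
Variable R : realType.
Local Notation C := (complex R).

Definition chi4 (a b : 'I_4) : C := if com4 a b then 1 else -1.

(* sigma_a sigma_b = ph4 a b sigma_(a xor b) *)
Definition ph4 (a b : 'I_4) : C :=
  match val a, val b with
  | 1, 2 | 2, 3 | 3, 1 => 'i
  | 2, 1 | 3, 2 | 1, 3 => - 'i
  | _, _ => 1 end.

Lemma sumI4 (F : 'I_4 -> C) : \sum_a F a =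
  F (@Ordinal 4 0 isT) + F (@Ordinal 4 1 isT) + F (@Ordinal 4 2 isT) + F (@Ordinal 4 3 isT).
Proof.
rewrite !big_ord_recl big_ord0 addr0 !addrA.
by congr (F _ + F _ + F _ + F _); apply: val_inj.
Qed.

Lemma mulii : 'i * 'i = -1 :> C.
Proof. by rewrite -expr2 sqrCi. Qed.

Lemma pauli1_conj s a b : (pauli1 R s a b)^* = pauli1 R s b a.
Proof.
by elim/ord4_ind: s; case: a; case: b;
  rewrite /pauli1 /= ?rmorph0 ?rmorph1 ?rmorphN ?rmorph1 /= ?conjCi ?opprK.
Qed.

Lemma pauli1M s t a b : \sum_c pauli1 R s a c * pauli1 R t c b =
  ph4 s t * pauli1 R (xor4 s t) a b.
Proof.
rewrite big_bool /=.
by elim/ord4_ind: s; elim/ord4_ind: t; case: a; case: b; rewrite /pauli1 /ph4 /=;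
  rewrite ?mulr0 ?mul0r ?mulr1 ?mul1r ?add0r ?addr0 ?mulrN ?mulNr
    ?mulii ?mulr1 ?mul1r ?opprK.
Qed.

Lemma ph4_expr4 s t : ph4 s t ^+ 4 = 1.
Proof.
have [->|[->|->]] : ph4 s t = 1 \/ ph4 s t = 'i \/ ph4 s t = - 'i.
- by elim/ord4_ind: s; elim/ord4_ind: t; rewrite /ph4; auto.
- exact: expr1n.
- by rewrite (exprM _ 2 2) sqrCi sqrrN expr1n.
- by rewrite (exprM _ 2 2) sqrrN sqrCi sqrrN expr1n.
Qed.

Lemma ph4_swap s t : ph4 s t = chi4 s t * ph4 t s.
Proof.
by elim/ord4_ind: s; elim/ord4_ind: t; rewrite /ph4 /chi4 /= ?mul1r ?mulN1r ?opprK.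
Qed.

Lemma ph4_id s : ph4 s s = 1.
Proof. by elim/ord4_ind: s. Qed.

Lemma chi4M s t u : chi4 (xor4 s t) u = chi4 s u * chi4 t u.
Proof.
by elim/ord4_ind: s; elim/ord4_ind: t; elim/ord4_ind: u;
  rewrite /chi4 /= ?mulr1 ?mul1r ?mulN1r ?opprK.
Qed.

(** In tensor form: the sum of sigma ⊗ sigma over the four Paulis is twice the swap operator. *)
Lemma pauli1_complete a b c e : \sum_s pauli1 R s a b * pauli1 R s c e =
  2 * ((a == e) && (b == c))%:R.
Proof.
rewrite sumI4; case: a; case: b; case: c; case: e; rewrite /pauli1 /=;
  rewrite ?mulr0 ?mul0r ?mulr1 ?mul1r ?add0r ?addr0 ?mulrN ?mulNr
    ?mulii ?mulr1 ?mul1r ?opprK //; ring.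
Qed.

(** In tensor form: I ⊗ I + Z ⊗ Z is twice the projector onto the span of |00> and |11>. *)
Lemma pauli1_diag_complete a b c e :
  \sum_(s : 'I_4 | (s == ord0) || (s == ord_max)) pauli1 R s a b * pauli1 R s c e =
  2 * ((a == b) && (c == e) && (a == c))%:R.
Proof.
rewrite big_mkcond sumI4; case: a; case: b; case: c; case: e; rewrite /pauli1 /=;
  rewrite ?mulr0 ?mul0r ?mulr1 ?mul1r ?add0r ?addr0 ?mulrN ?mulNr
    ?mulii ?mulr1 ?mul1r ?opprK //; ring.
Qed.

Lemma sum_chi4 t : \sum_s chi4 s t = 4 * (t == ord0)%:R.
Proof. by rewrite sumI4; elim/ord4_ind: t; rewrite /chi4 /=; ring. Qed.

Lemma pauli1_tr s : \sum_a pauli1 R s a a = 2 * (s == ord0)%:R.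
Proof. by rewrite big_bool; elim/ord4_ind: s; rewrite /pauli1 /=; ring. Qed.

End Single.

Lemma xor4C : commutative xor4.
Proof. by move=> s t; elim/ord4_ind: s; elim/ord4_ind: t; apply: val_inj. Qed.

Lemma xor4A : associative xor4.
Proof. by move=> s t u; elim/ord4_ind: s; elim/ord4_ind: t; elim/ord4_ind: u; apply: val_inj. Qed.

Lemma xor40 s : xor4 s ord0 = s.
Proof. by elim/ord4_ind: s; apply: val_inj. Qed.

Lemma xor4K s : xor4 s s = ord0.
Proof. by elim/ord4_ind: s; apply: val_inj. Qed.

Lemma com4C : commutative com4.
Proof. by move=> s t; elim/ord4_ind: s; elim/ord4_ind: t. Qed.

(** * Conjugate transpose *)

Section Adjoint.
Variable R : realType.
Local Notation C := (complex R).

Lemma dagM m p q (A : 'M[C]_(m, p)) (B : 'M[C]_(p, q)) :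
  dag (A *m B) = dag B *m dag A.
Proof. by rewrite /dag map_mxM trmx_mul. Qed.

Lemma dagK m p (A : 'M[C]_(m, p)) : dag (dag A) = A.
Proof. by apply/matrixP => i j; rewrite !mxE conjCK. Qed.

Lemma dagZ m p c (A : 'M[C]_(m, p)) : dag (c *: A) = c^* *: dag A.
Proof. by apply/matrixP => i j; rewrite !mxE rmorphM. Qed.

Lemma dagD m p (A B : 'M[C]_(m, p)) : dag (A + B) = dag A + dag B.
Proof. by apply/matrixP => i j; rewrite !mxE rmorphD. Qed.

Lemma dag1 m : dag (1%:M : 'M[C]_m) = 1%:M.
Proof. by rewrite /dag map_mx1 trmx1. Qed.

Lemma tr_dag m (A : 'M[C]_m) : \tr (dag A) = (\tr A)^*.
Proof. by rewrite /dag mxtrace_tr /mxtrace rmorph_sum; apply: eq_bigr => i _; rewrite mxE. Qed.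

End Adjoint.

(** * Pauli labels as an elementary abelian 2-group *)

Section Labels.
Variable n : nat.
Local Notation L := {ffun 'I_n -> 'I_4}.

Definition pauli0 : L := [ffun=> ord0].
Definition pauli_add (s t : L) : L := [ffun k => xor4 (s k) (t k)].
(** Here [ord_max] is the label 3 of Z, so these are the Paulis that are diagonal in the
    computational basis. *)
Definition ztype : {pred L} := ffun_on [pred a : 'I_4 | (a == ord0) || (a == ord_max)].

Lemma pauli_addC : commutative pauli_add.
Proof. by move=> s t; apply/ffunP => k; rewrite !ffunE xor4C. Qed.

Lemma pauli_addA : associative pauli_add.
Proof. by move=> s t u; apply/ffunP => k; rewrite !ffunE xor4A. Qed.

Lemma pauli_addx0 s : pauli_add s pauli0 = s.
Proof. by apply/ffunP => k; rewrite !ffunE xor40. Qed.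

Lemma pauli_addxx s : pauli_add s s = pauli0.
Proof. by apply/ffunP => k; rewrite !ffunE xor4K. Qed.

Lemma pauli_addK s t : pauli_add s (pauli_add s t) = t.
Proof. by rewrite pauli_addA pauli_addxx pauli_addC pauli_addx0. Qed.

Lemma pauli_add_eq0 s t : (pauli_add s t == pauli0) = (s == t).
Proof.
apply/eqP/eqP => [st0|->]; last exact: pauli_addxx.
by rewrite -(pauli_addK s t) st0 pauli_addx0.
Qed.

Lemma card_ztype : #|ztype| = (2 ^ n)%N.
Proof.
rewrite card_ffun_on card_ord; congr (_ ^ _)%N.
by rewrite -sum1_card big_mkcond !big_ord_recl big_ord0.
Qed.

Lemma ztype0 : pauli0 \in ztype.
Proof. by apply/ffun_onP => k; rewrite ffunE. Qed.

End Labels.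
Arguments pauli0 {n}.

(** * Pauli matrices on n qubits: commutation signs, characters and completeness *)

Section Paulis.
Variables (R : realType) (n : nat).
Local Notation C := (complex R).
Local Notation L := {ffun 'I_n -> 'I_4}.
Local Notation d := (2 ^ n)%N.
Local Notation P := (@pauli_mx R n).

(** The symplectic form on labels, written multiplicatively as a complex sign so that it can enter
    character sums directly. *)
Definition comm_sign (s t : L) : C := \prod_(k < n) chi4 R (s k) (t k).
Local Notation chi := comm_sign.
Definition phase (s t : L) : C := \prod_(k < n) ph4 R (s k) (t k).

Lemma dag_pauli s : dag (P s) = P s.
Proof.
apply/matrixP => i j; rewrite !mxE rmorph_prod; apply: eq_bigr => k _.
exact: pauli1_conj.
Qed.

Lemma pauli_mx0 : P pauli0 = 1%:M.
Proof.
apply/matrixP => i j; rewrite !mxE -prod_qbit_eq; apply: eq_bigr => k _.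
by rewrite ffunE /pauli1 /=; case: eqP.
Qed.

Lemma pauliM s t : P s *m P t = phase s t *: P (pauli_add s t).
Proof.
apply/matrixP => i j; rewrite !mxE /phase -big_split /=.
under eq_bigr do rewrite !mxE -big_split /=.
rewrite (sum_prod_qbit (fun k b => pauli1 R (s k) (qbit k i) b * pauli1 R (t k) b (qbit k j))).
by apply: eq_bigr => k _; rewrite pauli1M ffunE.
Qed.

Lemma phase_expr4 s t : phase s t ^+ 4 = 1.
Proof. by rewrite -prodrXl big1 // => k _; rewrite ph4_expr4. Qed.

Lemma phase_swap s t : phase s t = chi s t * phase t s.
Proof. by rewrite -big_split; apply: eq_bigr => k _; rewrite ph4_swap. Qed.

Lemma pauli_swap s t : P s *m P t = chi s t *: (P t *m P s).
Proof. by rewrite !pauliM phase_swap pauli_addC scalerA. Qed.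

Lemma pauli_sqr s : P s *m P s = 1%:M.
Proof.
rewrite pauliM pauli_addxx pauli_mx0 /phase big1 ?scale1r // => k _.
exact: ph4_id.
Qed.

Lemma chi4_sign a b : chi4 R a b = 1 \/ chi4 R a b = -1.
Proof. by rewrite /chi4; case: ifP; [left | right]. Qed.

Lemma chi_sign s t : chi s t = 1 \/ chi s t = -1.
Proof.
rewrite /comm_sign; elim/big_ind: _ => [|x y [->|->] [->|->]|k _].
- by left.
- by left; rewrite mulr1.
- by right; rewrite mul1r.
- by right; rewrite mulr1.
- by left; rewrite mulrNN mulr1.
- exact: chi4_sign.
Qed.

Lemma chiC s t : chi s t = chi t s.
Proof. by apply: eq_bigr => k _; rewrite /chi4 com4C. Qed.

Lemma chiDl s t u : chi (pauli_add s t) u = chi s u * chi t u.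
Proof. by rewrite -big_split; apply: eq_bigr => k _; rewrite ffunE chi4M. Qed.

Lemma chiDr s t u : chi s (pauli_add t u) = chi s t * chi s u.
Proof. by rewrite chiC chiDl !(chiC s). Qed.

Lemma chi0 s : chi s pauli0 = 1.
Proof.
by rewrite /comm_sign big1 // => k _; rewrite ffunE /chi4 /com4 eqxx orbT.
Qed.

Lemma chixx s : chi s s = 1.
Proof. by rewrite /comm_sign big1 // => k _; rewrite /chi4 /com4 eqxx !orbT. Qed.

Lemma label_eq_prod (s t : L) : \prod_(k < n) (s k == t k)%:R = (s == t)%:R :> C.
Proof.
rewrite prod_delta; congr (nat_of_bool _)%:R.
apply/forallP/eqP => [eqst|-> //]; by apply/ffunP => k; apply/eqP.
Qed.

(** Orthogonality of characters for a nondegenerate pairing; the sum factors over the qubits. *)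
Lemma sum_chi t : \sum_s chi s t = d%:R ^+ 2 * (t == pauli0)%:R.
Proof.
have -> : \sum_s chi s t = \prod_(k < n) \sum_a chi4 R a (t k).
  by rewrite bigA_distr_bigA.
under eq_bigr do rewrite sum_chi4.
rewrite big_split /= prodr_const card_ord -label_eq_prod; congr (_ * _).
  by rewrite natrX -exprM mulnC exprM; congr (_ ^+ _); rewrite -natrX.
by apply: eq_bigr => k _; rewrite ffunE.
Qed.

Lemma mxtrace_pauli s : \tr (P s) = d%:R * (s == pauli0)%:R.
Proof.
rewrite /mxtrace; under eq_bigr do rewrite mxE.
rewrite (sum_prod_qbit (fun k b => pauli1 R (s k) b b)).
under eq_bigr do rewrite pauli1_tr.
rewrite big_split /= prodr_const card_ord -label_eq_prod natrX; congr (_ * _).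
by apply: eq_bigr => k _; rewrite ffunE.
Qed.

Lemma natr_and (a b : bool) : (a && b)%:R = a%:R * b%:R :> C.
Proof. by rewrite -natrM mulnb. Qed.

(** The tensor power of the single-qubit swap identity; Parseval's identity [sum_coef] rests on
    it. *)
Lemma pauli_complete (i j k l : 'I_d) :
  \sum_s P s i j * P s k l = d%:R * ((i == l)%:R * (j == k)%:R).
Proof.
under eq_bigr do rewrite !mxE -big_split /=.
rewrite -(bigA_distr_bigA (fun (m : 'I_n) a => pauli1 R a (qbit m i) (qbit m j) *
  pauli1 R a (qbit m k) (qbit m l))).
under eq_bigr do rewrite pauli1_complete natr_and.
by rewrite !big_split /= prodr_const card_ord natrX !prod_qbit_eq.
Qed.

Lemma pauli_diag_complete (i j k l : 'I_d) :
  \sum_(s in @ztype n) P s i j * P s k l =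
  d%:R * ((i == j)%:R * (k == l)%:R * (i == k)%:R).
Proof.
under eq_bigr do rewrite !mxE -big_split /=.
rewrite -(bigA_distr_big _ (fun (m : 'I_n) a => pauli1 R a (qbit m i) (qbit m j) *
  pauli1 R a (qbit m k) (qbit m l))).
under eq_bigr do rewrite pauli1_diag_complete !natr_and.
by rewrite !big_split /= prodr_const card_ord natrX !prod_qbit_eq.
Qed.

(** Unnormalised Pauli coefficient: the expansion of [A] is d^-1 sum_s (coef A s) P_s. *)
Definition coef (A : 'M[C]_d) (s : L) : C := \tr (A *m P s).

Lemma coefE A s : coef A s = \sum_i \sum_j A i j * P s j i.
Proof. by apply: eq_bigr => i _; rewrite mxE. Qed.

Lemma d_neq0 : d%:R != 0 :> C.
Proof. by rewrite pnatr_eq0 -lt0n expn_gt0. Qed.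

(** Parseval's identity, in bilinear form: after expansion into matrix entries, completeness
    collapses the sum over labels. *)
Lemma sum_coef A B : \sum_s coef A s * coef B s = d%:R * \tr (A *m B).
Proof.
transitivity (\sum_i \sum_j \sum_k \sum_l A i j * B k l * \sum_s P s j i * P s l k).
  under eq_bigr do rewrite !coefE mulr_suml.
  rewrite exchange_big; apply: eq_bigr => i _.
  under eq_bigr do rewrite mulr_suml.
  rewrite exchange_big; apply: eq_bigr => j _.
  under eq_bigr do rewrite mulr_sumr.
  rewrite exchange_big; apply: eq_bigr => k _.
  under eq_bigr do rewrite mulr_sumr.
  rewrite exchange_big; apply: eq_bigr => l _.
  by rewrite mulr_sumr; apply: eq_bigr => s _; rewrite mulrACA.
rewrite /mxtrace mulr_sumr; apply: eq_bigr => i _.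
rewrite mxE mulr_sumr; apply: eq_bigr => j _.
rewrite (bigD1 j) //= [X in _ + X]big1 ?addr0 => [|k /negPf neqkj].
  rewrite (bigD1 i) //= [X in _ + X]big1 ?addr0 => [|l /negPf neqli].
    by rewrite pauli_complete !eqxx !mulr1 mulrC.
  by rewrite pauli_complete (eq_sym i) neqli !mulr0.
by rewrite big1 // => l _; rewrite pauli_complete (eq_sym j) neqkj !(mulr0, mul0r).
Qed.

(** Parseval's identity after dephasing: Z-type Paulis see only the diagonals. *)
Lemma sum_coef_ztype A B :
  \sum_(s in @ztype n) coef A s * coef B s = d%:R * \sum_b A b b * B b b.
Proof.
transitivity (\sum_i \sum_j \sum_k \sum_l
    A i j * B k l * \sum_(s in @ztype n) P s j i * P s l k).
  under eq_bigr do rewrite !coefE mulr_suml.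
  rewrite exchange_big; apply: eq_bigr => i _.
  under eq_bigr do rewrite mulr_suml.
  rewrite exchange_big; apply: eq_bigr => j _.
  under eq_bigr do rewrite mulr_sumr.
  rewrite exchange_big; apply: eq_bigr => k _.
  under eq_bigr do rewrite mulr_sumr.
  rewrite exchange_big; apply: eq_bigr => l _.
  by rewrite mulr_sumr; apply: eq_bigr => s _; rewrite mulrACA.
rewrite mulr_sumr; apply: eq_bigr => i _.
rewrite (bigD1 i) //= [X in _ + X]big1 ?addr0 => [|j /negPf neqji].
  rewrite (bigD1 i) //= [X in _ + X]big1 ?addr0 => [|k /negPf neqki].
    rewrite (bigD1 i) //= [X in _ + X]big1 ?addr0 => [|l /negPf neqli].
      by rewrite pauli_diag_complete !eqxx !mulr1 mulrC.
    by rewrite pauli_diag_complete neqli !(mulr0, mul0r).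
  rewrite big1 // => l _; rewrite pauli_diag_complete.
  have [->|_] := eqVneq l k; last by rewrite !(mulr0, mul0r).
  by rewrite (eq_sym i k) neqki !mulr0.
rewrite big1 // => k _; rewrite big1 // => l _.
by rewrite pauli_diag_complete neqji !(mulr0, mul0r).
Qed.

Lemma mxtrace_delta (A : 'M[C]_d) i j : \tr (A *m delta_mx j i) = A i j.
Proof.
rewrite /mxtrace (bigD1 i) //= [X in _ + X]big1 ?addr0 => [|k /negPf neqki].
  rewrite mxE (bigD1 j) //= [X in _ + X]big1 ?addr0 => [|k /negPf neqkj].
    by rewrite mxE !eqxx mulr1.
  by rewrite mxE neqkj mulr0.
by rewrite mxE big1 // => l _; rewrite mxE neqki andbF mulr0.
Qed.

Lemma coef_inj A B : (forall s, coef A s = coef B s) -> A = B.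
Proof.
move=> eqAB; apply/matrixP => i j; apply: (mulfI d_neq0).
rewrite -!(mxtrace_delta _ i j) -!sum_coef.
by apply: eq_bigr => s _; rewrite eqAB.
Qed.

Lemma coef_pauli s t : coef (P s) t = d%:R * (s == t)%:R.
Proof.
rewrite /coef pauliM mxtraceZ mxtrace_pauli pauli_add_eq0.
have [->|_] := eqVneq s t; last by rewrite !mulr0.
by rewrite /phase big1 ?mul1r // => k _; rewrite ph4_id.
Qed.

Lemma coef0 A : coef A pauli0 = \tr A.
Proof. by rewrite /coef pauli_mx0 mulmx1. Qed.

Lemma coef_conj A s : dag A = A -> (coef A s)^* = coef A s.
Proof. by move=> hA; rewrite /coef -tr_dag dagM dag_pauli hA mxtrace_mulC. Qed.

End Paulis.

(** * Action of Clifford unitaries on Pauli labels *)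

Section Clifford.
Variables (R : realType) (n : nat).
Local Notation C := (complex R).
Local Notation L := {ffun 'I_n -> 'I_4}.
Local Notation d := (2 ^ n)%N.
Local Notation P := (@pauli_mx R n).
Local Notation chi := (@comm_sign R n).

Definition cj (U A : 'M[C]_d) : 'M[C]_d := U *m A *m dag U.

Lemma scale1_inj (a b : C) : a *: (1%:M : 'M[C]_d) = b *: 1%:M -> a = b.
Proof.
move=> /(congr1 mxtrace); rewrite !mxtraceZ mxtrace1 => eqab.
exact: (mulIf (d_neq0 R n)).
Qed.

Lemma cjM U A B : dag U *m U = 1%:M -> cj U A *m cj U B = cj U (A *m B).
Proof.
by move=> hU; rewrite /cj !mulmxA -(mulmxA _ (dag U) U) hU mulmx1.
Qed.

Lemma cj_mul U V A : cj (U *m V) A = cj U (cj V A).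
Proof. by rewrite /cj dagM !mulmxA. Qed.

Lemma cjZ U c A : cj U (c *: A) = c *: cj U A.
Proof. by rewrite /cj -scalemxAr -scalemxAl. Qed.

Lemma cjZl U c A : cj (c *: U) A = (c * c^*) *: cj U A.
Proof. by rewrite /cj dagZ -!scalemxAl -scalemxAr scalerA. Qed.

Lemma mxtrace_cj U A : dag U *m U = 1%:M -> \tr (cj U A) = \tr A.
Proof. by move=> hU; rewrite /cj mxtrace_mulC mulmxA hU mul1mx. Qed.

(** The fourth root of unity allowed by [clifford] is in fact a sign, because the conjugate of an
    involution is an involution. Distinct labels stay distinct because conjugation preserves trace
    orthogonality. *)
Lemma clifford_label U : clifford U -> exists pi : L -> L, exists c : L -> C,
  injective pi /\ forall s, c s * c s = 1 /\ cj U (P s) = c s *: P (pi s).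
Proof.
move=> [UU hU]; have U'U : dag U *m U = 1%:M by exact: mulmx1C.
have /choice[f fP] : forall s, exists p : L * C,
    p.2 * p.2 = 1 /\ cj U (P s) = p.2 *: P p.1.
  move=> s; have [t [c [_ Ust]]] := hU s; exists (t, c); split=> //=.
  apply: scale1_inj; rewrite -{1}(pauli_sqr R t) scale1r.
  have := cjM (P s) (P s) U'U; rewrite pauli_sqr /cj mulmx1 UU Ust => <-.
  by rewrite -scalemxAl -scalemxAr scalerA.
exists (fun s => (f s).1), (fun s => (f s).2); split=> [s t eqst|//].
have [cs1 cjs] := fP s; have [ct1 cjt] := fP t.
apply/eqP; apply/negPn/negP => /negPf neqst.
have : coef (cj U (P s) *m cj U (P t)) pauli0 = 0.
  by rewrite coef0 cjM // mxtrace_cj // -/(coef _ _) coef_pauli neqst mulr0.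
rewrite cjs cjt eqst -scalemxAl -scalemxAr scalerA pauli_sqr coef0 mxtraceZ mxtrace1.
move=> /eqP; rewrite !mulf_eq0 (negPf (d_neq0 R n)) orbF => /orP[]/eqP c0.
  by move/eqP: cs1; rewrite c0 mul0r eq_sym oner_eq0.
by move/eqP: ct1; rewrite c0 mul0r eq_sym oner_eq0.
Qed.

(* [stab U s] : the Pauli operator [s] belongs, up to sign, to the stabilizer
   group of the basis [U^dag |b>] *)
Definition stab (U : 'M[C]_d) (s : L) : bool :=
  [exists z in @ztype n, coef (cj U (P s)) z != 0].

(** The definition of [stab] involves no choice of a label map; it can be read off from one because
    a multiple of [P t] has its only nonzero Pauli coefficient at [t]. *)
Lemma stabE U c s t : c != 0 -> cj U (P s) = c *: P t -> stab U s = (t \in @ztype n).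
Proof.
move=> c0 eqU.
have coefE z : (coef (cj U (P s)) z != 0) = (t == z).
  rewrite eqU /coef -scalemxAl mxtraceZ -/(coef _ _) coef_pauli !mulf_eq0.
  rewrite (negPf c0) (negPf (d_neq0 R n)) /= pnatr_eq0.
  by case: (t == z).
rewrite /stab; apply/existsP/idP => [[z /andP[hz]]|ht].
  by rewrite coefE => /eqP->.
by exists t; rewrite ht coefE eqxx.
Qed.

Lemma stabZ U c s : c != 0 -> stab (c *: U) s = stab U s.
Proof.
move=> c0; apply: eq_existsb => z; rewrite cjZl /coef -scalemxAl mxtraceZ.
by rewrite !mulf_eq0 conjC_eq0 (negPf c0).
Qed.

Lemma stab_mul U V c s t : c != 0 -> cj V (P s) = c *: P t ->
  stab (U *m V) s = stab U t.
Proof.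
move=> c0 eqV; apply: eq_existsb => z.
by rewrite cj_mul eqV cjZ /coef -scalemxAl mxtraceZ mulf_eq0 (negPf c0).
Qed.

Lemma sqr1_neq0 (c : C) : c * c = 1 -> c != 0.
Proof. by move=> c1; apply/eqP => c0; move/eqP: c1; rewrite c0 mul0r eq_sym oner_eq0. Qed.

Lemma stab0 U : clifford U -> stab U pauli0.
Proof.
move=> [UU _]; rewrite (@stabE _ 1 _ pauli0) ?ztype0 ?oner_neq0 //.
by rewrite pauli_mx0 /cj mulmx1 UU scale1r.
Qed.

(** Z-type Paulis commute with each other, and conjugation by [U] reflects commutation. *)
Lemma stab_chi U s t : clifford U -> stab U s -> stab U t -> chi s t = 1.
Proof.
move=> hU; have [UU _] := hU; have U'U : dag U *m U = 1%:M by exact: mulmx1C.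
have [pi [c [_ piP]]] := clifford_label hU.
have [cs1 eqs] := piP s; have [ct1 eqt] := piP t.
rewrite (stabE (sqr1_neq0 cs1) eqs) (stabE (sqr1_neq0 ct1) eqt) => zs zt.
have chiz : chi (pi s) (pi t) = 1.
  rewrite /comm_sign big1 // => k _.
  move/ffun_onP: zs => /(_ k); move/ffun_onP: zt => /(_ k).
  by rewrite !inE => /orP[]/eqP-> /orP[]/eqP->.
have /eqP : cj U (P s *m P t) = cj U (P t *m P s).
  by rewrite -!cjM // eqs eqt -!scalemxAl -!scalemxAr pauli_swap chiz scale1r !scalerA mulrC.
rewrite [in X in X == _]pauli_swap cjZ -subr_eq0 => /eqP.
rewrite -[X in _ - X]scale1r -scalerBl pauliM cjZ.
set u := pauli_add t s; have [cu1 equ] := piP u; rewrite equ !scalerA.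
(* Multiplying by the involution [P (pi u)] leaves a scalar equation whose factors other than
   [chi s t - 1] are nonzero. *)
move=> /(congr1 (fun X => X *m P (pi u))); rewrite mul0mx -scalemxAl pauli_sqr.
move=> z0; have /eqP := scale1_inj (etrans z0 (esym (scale0r _))).
rewrite !mulf_eq0 (negPf (sqr1_neq0 cu1)) orbF subr_eq0 => /orP[/eqP//|/eqP ph0].
by have /eqP := phase_expr4 R t s; rewrite ph0 expr0n /= eq_sym oner_eq0.
Qed.

(** This is [sum_coef_ztype] relabelled along the action of [U]. Each sign occurs once for [A] and
    once for [B], hence squares to 1. *)
Lemma diag_sum U A B : clifford U ->
  \sum_(b < d) cj U A b b * cj U B b b =
  d%:R^-1 * \sum_s (stab U s)%:R * (coef A s * coef B s).
Proof.
move=> hU; have [UU _] := hU; have U'U : dag U *m U = 1%:M by exact: mulmx1C.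
have [pi [c [pi_inj piP]]] := clifford_label hU.
apply: (mulfI (d_neq0 R n)); rewrite mulVKf ?d_neq0 // -sum_coef_ztype.
rewrite (reindex_inj pi_inj) big_mkcond; apply: eq_bigr => s _.
have [cs1 eqs] := piP s; rewrite (stabE (sqr1_neq0 cs1) eqs).
case: (pi s \in _); rewrite ?mul0r ?mul1r //.
have coefc X : coef (cj U X) (pi s) = c s * coef X s.
  have Ppi : P (pi s) = c s *: cj U (P s) by rewrite eqs scalerA cs1 scale1r.
  by rewrite /coef Ppi -scalemxAr mxtraceZ cjM // mxtrace_cj.
by rewrite !coefc mulrACA cs1 mul1r.
Qed.

Lemma sum_stab U : clifford U -> \sum_s (stab U s)%:R = d%:R :> C.
Proof.
move=> hU; have [pi [c [pi_inj piP]]] := clifford_label hU.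
rewrite -(card_ztype n) -sum1_card natr_sum [RHS]big_mkcond [RHS](reindex_inj pi_inj).
apply: eq_bigr => s _; have [cs1 eqs] := piP s.
by rewrite (stabE (sqr1_neq0 cs1) eqs); case: (_ \in _).
Qed.

(** * Clifford products, symplectic transvections and separation of labels *)

Lemma clifford1 : clifford (1%:M : 'M[C]_d).
Proof.
split=> [|s]; first by rewrite dag1 mulmx1.
by exists s, 1; rewrite expr1n dag1 mul1mx mulmx1 scale1r.
Qed.

Lemma clifford_mul (U V : 'M[C]_d) : clifford U -> clifford V -> clifford (U *m V).
Proof.
move=> [UU hU] [VV hV]; split=> [|s].
  by rewrite dagM mulmxA -(mulmxA U) VV mulmx1.
have [t [c [c4 Vs]]] := hV s; have [u [e [e4 Ut]]] := hU t.
exists u, (c * e); rewrite exprMn c4 e4 mulr1; split=> //.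
by rewrite -/(cj _ _) cj_mul /cj Vs -/(cj U _) cjZ /cj Ut scalerA.
Qed.

(* Up to a global phase this is [exp (i pi/4 P_p)]; it acts on Pauli labels as
   the symplectic transvection along [p]. *)
Definition transvection (p : L) : 'M[C]_d :=
  ((1 + 'i) / 2) *: (1%:M + 'i *: P p).

(** The factors (1 + chi)/2 and (1 - chi)/2 are the indicators of commuting and anticommuting, which
    puts both cases into one formula. *)
Lemma cj_transvection p s : cj (transvection p) (P s) =
  ((1 + chi p s) / 2) *: P s + ('i * ((1 - chi p s) / 2)) *: (P p *m P s).
Proof.
rewrite /transvection cjZl /cj dagD dag1 dagZ dag_pauli conjCi.
(* The prefactor has modulus 1/sqrt 2, so it normalises the transvection without a square root. *)
have -> : (1 + 'i) / 2 * ((1 + 'i) / 2)^* = 1 / 2 :> C.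
  rewrite rmorphM rmorphD /= conjCi rmorph1 fmorphV /= conjC_nat.
  have := sqrCi C; set i := 'i => ii.
  have -> : (1 + i) / 2 * ((1 - i) / 2) = (1 - i ^+ 2) / 4 by field.
  by rewrite ii; field.
rewrite !mulmxDl !mulmxDr !mul1mx !mulmx1 -!scalemxAl -!scalemxAr scaleNr.
have -> : P s *m P p = chi p s *: (P p *m P s) by rewrite pauli_swap chiC.
have -> : P p *m P s *m P p = chi p s *: P s.
  by rewrite (pauli_swap _ p s) -scalemxAl -mulmxA pauli_sqr mulmx1.
move: (P s) (P p *m P s) (chi p s) => A B x.
apply/matrixP => k l; rewrite !mxE; move: (A k l) (B k l) => a b.
have ii := mulii R; set i := 'i in ii *.
transitivity (((a - i * (x * b)) + i * b - (i * i) * (x * a)) / 2); first by field.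
by rewrite ii; field.
Qed.

Lemma cj_transvection1 p s : chi p s = 1 -> cj (transvection p) (P s) = P s.
Proof.
move=> chi1; rewrite cj_transvection chi1 subrr mul0r mulr0 scale0r addr0.
by have -> : (1 + 1) / 2 = 1 :> C; [field | rewrite scale1r].
Qed.

Lemma cj_transvectionN1 p s : chi p s = -1 ->
  cj (transvection p) (P s) = ('i * phase R p s) *: P (pauli_add p s).
Proof.
move=> chi1; rewrite cj_transvection chi1 subrr mul0r scale0r add0r opprK.
by have -> : (1 + 1) / 2 = 1 :> C; [field | rewrite mulr1 pauliM scalerA].
Qed.

Lemma clifford_transvection p : clifford (transvection p).
Proof.
split=> [|s].
  by have := cj_transvection1 (chi0 R p); rewrite /cj pauli_mx0 mulmx1.
rewrite -/(cj _ _); have [chi1|chi1] := chi_sign R p s.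
  by exists s, 1; rewrite expr1n cj_transvection1 // scale1r.
exists (pauli_add p s), ('i * phase R p s); split; last exact: cj_transvectionN1.
by rewrite exprMn phase_expr4 mulr1 (exprM _ 2 2) sqrCi sqrrN expr1n.
Qed.

(* The number of such [c] is 1/8 of the character sum in the proof. *)
Lemma label_separation (a b b' : L) : b != pauli0 -> b' != pauli0 ->
  b != a -> b' != a ->
  exists c, [/\ chi c a = 1, chi c b = -1 & chi c b' = -1].
Proof.
move=> b0 b'0 ba b'a; apply/not_existsP => noc.
have : \sum_c (1 + chi c a) * (1 - chi c b) * (1 - chi c b') = 0.
  apply: big1 => c _; have := noc c.
  have [->|->] := chi_sign R c a; last by rewrite subrr !mul0r.
  have [->|->] := chi_sign R c b; first by rewrite subrr mulr0 mul0r.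
  have [->|->] := chi_sign R c b'; first by rewrite subrr mulr0.
  by case.
have -> : \sum_c (1 + chi c a) * (1 - chi c b) * (1 - chi c b') =
    \sum_c chi c pauli0 + \sum_c chi c a - \sum_c chi c b -
    \sum_c chi c (pauli_add a b) - \sum_c chi c b' - \sum_c chi c (pauli_add a b')
    + \sum_c chi c (pauli_add b b') + \sum_c chi c (pauli_add a (pauli_add b b')).
  rewrite -big_split /= -!sumrB -!big_split /=; apply: eq_bigr => c _.
  rewrite !chiDr chi0; ring.
(* The hypotheses make the four characters with a minus sign nontrivial, so their sums vanish; what
   remains is d^2 times a positive integer. *)
rewrite !sum_chi !pauli_add_eq0 eqxx (negPf b0) (negPf b'0).
rewrite (eq_sym a b) (eq_sym a b') (negPf ba) (negPf b'a) !mulr0 !subr0 -!mulrDr.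
move/eqP; rewrite mulf_eq0 expf_eq0 (negPf (d_neq0 R n)) andbF /=.
by rewrite -!natrD pnatr_eq0.
Qed.

End Clifford.

(** * Averages over the Clifford group and the joint law of stabilizer membership *)

Section Average.
Variables (R : realType) (n : nat).
Local Notation C := (complex R).
Local Notation L := {ffun 'I_n -> 'I_4}.
Local Notation d := (2 ^ n)%N.
Local Notation P := (@pauli_mx R n).
Local Notation chi := (@comm_sign R n).
Variables (cs : seq 'M[C]_d) (hcs : clifford_transversal cs).

Lemma transversal_size_neq0 : (size cs)%:R != 0 :> C.
Proof.
have [_ _ _ hrep] := hcs; have [V Vcs _] := hrep _ (clifford1 R n).
by rewrite pnatr_eq0; case: (cs) Vcs.
Qed.

Lemma avgU_cst c : avgU cs (fun=> c) = c.
Proof.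
rewrite /avgU big_const_seq count_predT iter_addr_0.
by rewrite -[c *+ _]mulr_natl mulKf ?transversal_size_neq0.
Qed.

Lemma eq_avgU f g : (forall U, clifford U -> f U = g U) -> avgU cs f = avgU cs g.
Proof.
move=> eqfg; have [hcl _ _ _] := hcs; congr (_ * _).
by apply: eq_big_seq => U Ucs; rewrite eqfg //; apply: hcl.
Qed.

Lemma avgU_sum (I : finType) (f : I -> 'M[C]_d -> C) :
  avgU cs (fun U => \sum_i f i U) = \sum_i avgU cs (f i).
Proof. by rewrite /avgU exchange_big mulr_sumr. Qed.

Lemma avgUZ c f : avgU cs (fun U => c * f U) = c * avgU cs f.
Proof. by rewrite /avgU -mulr_sumr mulrCA. Qed.

Lemma clifford_scale_neq0 (U V : 'M[C]_d) c : clifford U -> U = c *: V -> c != 0.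
Proof.
move=> [UU _] eqU; apply/eqP => c0; move: UU.
rewrite eqU c0 scale0r mul0mx => /(congr1 mxtrace)/eqP.
by rewrite mxtrace0 mxtrace1 eq_sym (negPf (d_neq0 R n)).
Qed.

(** Right multiplication by [V] permutes the transversal up to nonzero scalars, which [g] does not
    see. *)
Lemma avgU_mulr (g : 'M[C]_d -> C) V : clifford V ->
  (forall c U, c != 0 -> g (c *: U) = g U) ->
  avgU cs (fun U => g (U *m V)) = avgU cs g.
Proof.
move=> hV gZ; have [hcl cs_uniq cs_inj hrep] := hcs.
have [VV _] := hV.
(* [rep U] represents the class of [U *m V]; outside [cs] its value is arbitrary. *)
have /choice[rep repP] : forall U, exists W, U \in cs ->
    W \in cs /\ exists c, c != 0 /\ U *m V = c *: W.
  move=> U; have [Ucs|_] := boolP (U \in cs); last by exists U.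
  have hUV := clifford_mul (hcl _ Ucs) hV.
  have [W Wcs [c eqW]] := hrep _ hUV; exists W => _; split=> //; exists c; split=> //.
  exact: clifford_scale_neq0 eqW.
have rep_inj : {in cs &, injective rep}.
  move=> U1 U2 U1cs U2cs eqr; apply: cs_inj => //.
  have [_ [c1 [c10 eq1]]] := repP _ U1cs; have [_ [c2 [c20 eq2]]] := repP _ U2cs.
  exists (c1 / c2); rewrite -[U1]mulmx1 -VV mulmxA eq1 eqr.
  have -> : rep U2 = c2^-1 *: (U2 *m V) by rewrite eq2 scalerA mulVf // scale1r.
  by rewrite scalerA -scalemxAl -mulmxA VV mulmx1.
have map_uniq : uniq (map rep cs) by rewrite map_inj_in_uniq.
have map_sub : {subset map rep cs <= cs}.
  by move=> _ /mapP[U Ucs ->]; have [] := repP _ Ucs.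
have [|_ eq_mem] := uniq_min_size map_uniq map_sub; first by rewrite size_map.
have perm : perm_eq (map rep cs) cs by apply: uniq_perm.
rewrite /avgU -[in RHS](perm_big _ perm) big_map; congr (_ * _).
by apply: eq_big_seq => U Ucs; have [_ [c [c0 ->]]] := repP _ Ucs; rewrite gZ.
Qed.

(** The probability that [s] and [t] both belong to the random set S_U; [stab2 s s] is the
    marginal. *)
Definition stab2 (s t : L) : C :=
  avgU cs (fun U => (stab U s)%:R * (stab U t)%:R).

Lemma stab2_conj V s t s' t' (c e : C) : clifford V -> c != 0 -> e != 0 ->
  cj V (P s) = c *: P s' -> cj V (P t) = e *: P t' -> stab2 s' t' = stab2 s t.
Proof.
move=> hV c0 e0 eqs eqt.
transitivity (avgU cs (fun U => (stab (U *m V) s)%:R * (stab (U *m V) t)%:R)).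
  by apply: eq_avgU => U _; rewrite (stab_mul _ c0 eqs) (stab_mul _ e0 eqt).
have gZ (c' : C) (U : 'M[C]_d) : c' != 0 -> (stab (c' *: U) s)%:R * (stab (c' *: U) t)%:R =
    (stab U s)%:R * (stab U t)%:R :> C by move=> c'0; rewrite !stabZ.
exact: (@avgU_mulr (fun U => (stab U s)%:R * (stab U t)%:R) V hV gZ).
Qed.

Lemma stab2C s t : stab2 s t = stab2 t s.
Proof. by rewrite /stab2; apply: eq_avgU => U _; apply: mulrC. Qed.

(** The trivial label always belongs to S_U, so marginals are joint probabilities with [pauli0], and
    results on pairs apply to them. *)
Lemma stab2_0l s : stab2 pauli0 s = stab2 s s.
Proof.
rewrite /stab2; apply: eq_avgU => U hU.
by rewrite (stab0 hU); case: (stab U s); rewrite ?mulr0.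
Qed.

Lemma stab2_00 : stab2 pauli0 pauli0 = 1.
Proof.
rewrite -[RHS]avgU_cst /stab2; apply: eq_avgU => U hU.
by rewrite (stab0 hU) mul1r.
Qed.

(** The set S_U has exactly d elements for every Clifford [U]. *)
Lemma sum_stab2 s : \sum_t stab2 s t = d%:R * stab2 s s.
Proof.
rewrite /stab2 -avgU_sum -avgUZ; apply: eq_avgU => U hU.
by rewrite -mulr_sumr sum_stab // mulrC -(natrM _ (stab U s)) mulnb andbb.
Qed.

Lemma stab2_N1 s t : chi s t = -1 -> stab2 s t = 0.
Proof.
move=> st; rewrite -[RHS]avgU_cst /stab2; apply: eq_avgU => U hU.
have [hs|] := boolP (stab U s); last by rewrite mul0r.
have [ht|] := boolP (stab U t); last by rewrite mulr0.
have /eqP := stab_chi hU hs ht; rewrite st -subr_eq0 -opprD oppr_eq0.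
by rewrite -(natrD _ 1 1) pnatr_eq0.
Qed.

Lemma stab2Mr s t x :
  stab2 s t * x = avgU cs (fun U => (stab U s)%:R * (stab U t)%:R * x).
Proof. by rewrite mulrC /stab2 -avgUZ; apply: eq_avgU => U _; apply: mulrC. Qed.

(* Unfolding [stab2] makes failing unifications blow up. *)
Local Opaque stab2.

(* The transvection along [b + b'] fixes [a] and maps [b] to [b']. *)
Lemma stab2_anticomm a b b' : chi a b = 1 -> chi a b' = 1 -> chi b b' = -1 ->
  stab2 a b = stab2 a b'.
Proof.
move=> ab ab' bb'; pose p := pauli_add b b'.
have pa : chi p a = 1 by rewrite chiDl !(chiC _ _ a) ab ab' mulr1.
have pb : chi p b = -1 by rewrite chiDl chixx (chiC _ _ b) bb' mul1r.
symmetry; apply: (@stab2_conj (transvection R p) _ _ _ _ 1 ('i * phase R p b)).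
- exact: clifford_transvection.
- exact: oner_neq0.
- apply/eqP => z; have := @phase_expr4 R n p b.
  have : ('i * phase R p b) ^+ 4 = 1.
    by rewrite exprMn phase_expr4 mulr1 (exprM _ 2 2) sqrCi sqrrN expr1n.
  by rewrite z expr0n /= => /eqP; rewrite eq_sym oner_eq0.
- by rewrite scale1r (cj_transvection1 pa).
- rewrite (cj_transvectionN1 pb); congr (_ *: P _).
  by rewrite /p (pauli_addC b b') -pauli_addA pauli_addxx pauli_addx0.
Qed.

(** Two transvections suffice, through an intermediate label [c] that commutes with [a] and
    anticommutes with both [b] and [b']. *)
Lemma stab2_const a b b' : b != pauli0 -> b' != pauli0 -> b != a -> b' != a ->
  chi a b = 1 -> chi a b' = 1 -> stab2 a b = stab2 a b'.
Proof.
move=> b0 b'0 ba b'a ab ab'.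
have [c [ca cb cb']] := label_separation R b0 b'0 ba b'a.
have ac : chi a c = 1 by rewrite chiC ca.
have bc : chi b c = -1 by rewrite chiC cb.
by rewrite (stab2_anticomm ab ac bc) (stab2_anticomm ac ab' cb').
Qed.

Lemma sum_card_labels : \sum_(s : L) 1 = d%:R ^+ 2 :> C.
Proof.
have := sum_chi R (@pauli0 n); rewrite eqxx mulr1 => <-.
by apply: eq_bigr => s _; rewrite chi0.
Qed.

Lemma sum_delta (v : L) (x : C) : \sum_u (u == v)%:R * x = x.
Proof.
rewrite (bigD1 v) //= big1 => [|u /negPf->]; last by rewrite mul0r.
by rewrite eqxx addr0 mul1r.
Qed.

Hypothesis n_gt0 : (0 < n)%N.

Lemma d_gt1 : 1 < d%:R :> C.
Proof. by rewrite ltr1n -{1}(expn0 2) ltn_exp2l. Qed.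

Lemma dD1_neq0 : d%:R + 1 != 0 :> C.
Proof. by rewrite -(natrD _ d 1) pnatr_eq0 addn1. Qed.

Lemma dD2_neq0 : d%:R + 2 != 0 :> C.
Proof. by rewrite -(natrD _ d 2) pnatr_eq0 addn2. Qed.

(** All nontrivial labels share one marginal w, and counting S_U gives 1 + (d^2 - 1) w = d;
    cancelling d - 1 requires [n_gt0]. *)
Lemma stab2_diag s : s != pauli0 -> stab2 s s = (d%:R + 1)^-1.
Proof.
move=> s0; rewrite -stab2_0l.
have eqw t : stab2 pauli0 t = stab2 pauli0 s + (t == pauli0)%:R * (1 - stab2 pauli0 s).
  have [->|t0] := eqVneq t pauli0; first by rewrite stab2_00 mul1r addrC subrK.
  by rewrite mul0r addr0; apply: stab2_const; rewrite // chiC chi0.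
have := sum_stab2 pauli0; rewrite stab2_00 mulr1.
under eq_bigr do rewrite eqw.
rewrite big_split /= sum_delta -[X in \sum_i X]mulr1 -mulr_sumr sum_card_labels.
move: (stab2 _ _) => w eqd; apply: (mulfI (_ : d%:R - 1 != 0)).
  by rewrite subr_eq0; apply/eqP => d1; have := d_gt1; rewrite d1 ltxx.
apply: (mulfI dD1_neq0); rewrite [RHS]mulrCA mulfV ?dD1_neq0 // mulr1.
have -> : (d%:R + 1) * ((d%:R - 1) * w) = (d%:R ^+ 2 * w + (1 - w)) - 1 by ring.
by rewrite [w * _]mulrC in eqd; rewrite eqd.
Qed.

(* For [d = 2] the counting argument of [stab2E] divides by [d - 2 = 0], but
   there is no pair of distinct nontrivial commuting labels. *)
Lemma chi_qubit1 (s t : L) : n = 1%N -> chi s t = 1 ->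
  [\/ s = pauli0, t = pauli0 | s = t].
Proof.
clear n_gt0; move: n s t => m s t m1; subst m.
rewrite /comm_sign big_ord_recl big_ord0 mulr1.
rewrite /chi4; case: ifP => [/or3P[]/eqP st _|_ /eqP].
- by constructor 1; apply/ffunP => k; rewrite ord1 ffunE.
- by constructor 2; apply/ffunP => k; rewrite ord1 ffunE.
- by constructor 3; apply/ffunP => k; rewrite ord1.
by rewrite eq_sym -subr_eq0 opprK -(natrD _ 1 1) pnatr_eq0.
Qed.

(** For distinct commuting labels, count S_U given that it contains [s]: with w the marginal and k
    the wanted value, 2 w + (d^2/2 - 2) k = d w, since d^2/2 labels commute with [s], among them
    [pauli0] and [s] itself. *)
Lemma stab2E s t : s != pauli0 -> t != pauli0 ->
  stab2 s t = ((1 + chi s t) + d%:R * (s == t)%:R) / ((d%:R + 1) * (d%:R + 2)).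
Proof.
move=> s0 t0; have [<-|neqst] := eqVneq s t.
  rewrite stab2_diag // chixx mulr1; have := dD1_neq0; have := dD2_neq0.
  by move=> ? ?; field; apply/andP.
rewrite mulr0 addr0; have [st|st] := chi_sign R s t; last first.
  by rewrite st subrr mul0r stab2_N1.
have d2 : d%:R - 2 != 0 :> C.
  rewrite subr_eq0 eqr_nat; apply/eqP => d2.
  have n1 : n = 1%N by apply: (@expnI 2).
  by have [/eqP|/eqP|/eqP] := chi_qubit1 n1 st; apply/negP.
set k := stab2 s t; set w := (d%:R + 1)^-1 : C.
(* The constant [k] times the indicator of commuting with [s], corrected to [w] at the two
   exceptional labels. *)
have eqw u : stab2 s u = k * ((1 + chi u s) / 2) +
    ((u == pauli0)%:R * (w - k) + (u == s)%:R * (w - k)).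
  have [->|u0] := eqVneq u pauli0.
    rewrite stab2C stab2_0l stab2_diag // chiC chi0 eq_sym (negPf s0) -/w.
    by rewrite mul1r mul0r; field.
  have [->|us] := eqVneq u s; first by rewrite stab2_diag // chixx -/w mul1r mul0r; field.
  rewrite !mul0r !addr0 (chiC _ u s); have [su|su] := chi_sign R s u.
    rewrite su; have -> : (1 + 1) / 2 = 1 :> C by field.
    by rewrite mulr1; apply: stab2_const; rewrite // eq_sym.
  by rewrite su subrr mul0r mulr0 stab2_N1.
have := sum_stab2 s; under eq_bigr do rewrite eqw.
rewrite !big_split /= !sum_delta -mulr_sumr -mulr_suml big_split /= sum_card_labels sum_chi.
rewrite (negPf s0) mulr0 addr0 stab2_diag // -/w st.
move=> eqk; apply: (mulfI d2); apply: (mulfI dD2_neq0); apply: (mulfI dD1_neq0).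
transitivity ((d%:R + 1) *
  (2 * (k * (d%:R ^+ 2 / 2) + ((w - k) + (w - k))) - 4 * w)); first by field.
by rewrite eqk /w; field; rewrite dD1_neq0 dD2_neq0.
Qed.

(** The channel is diagonal in the Pauli basis: tracing against [P s] produces the sum of
    [diag_sum], in which only the label [s] survives. *)
Lemma coef_Mchan X s : coef (Mchan cs X) s = stab2 s s * coef X s.
Proof.
rewrite /coef /Mchan -scalemxAl mxtraceZ mulmx_suml raddf_sum /=.
transitivity (avgU cs (fun U => \sum_b cj U X b b * cj U (P s) b b)).
  congr (_ * _); apply: eq_bigr => U _; rewrite mulmx_suml raddf_sum /=.
  apply: eq_bigr => b _; rewrite -scalemxAl mxtraceZ; congr (_ * _).
  by rewrite -!mulmxA mxtrace_mulC -mulmxA mxtrace_mulC mxtrace_delta.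
rewrite -/(coef X s) mulrC -avgUZ; apply: eq_avgU => U hU.
rewrite diag_sum // (bigD1 s) //= big1 ?addr0 => [|t].
  rewrite coef_pauli eqxx mulr1 -natrM mulnb andbb.
  by rewrite mulrCA (mulrC (coef X s)) mulKf ?d_neq0 // mulrC.
by rewrite coef_pauli eq_sym => /negPf->; rewrite !mulr0.
Qed.

Lemma coef_Minv O s : \tr O = 0 -> coef (Minv cs O) s = (d%:R + 1) * coef O s.
Proof.
move=> trO.
(* An explicit preimage, without which [xget] could return its default value 0. *)
have exX : Mchan cs ((d%:R + 1) *: O) = O.
  apply: coef_inj => t; rewrite coef_Mchan /coef -scalemxAl mxtraceZ -/(coef O t).
  have [->|t0] := eqVneq t pauli0; first by rewrite coef0 trO !mulr0.
  by rewrite stab2_diag // mulKf ?dD1_neq0.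
have /= MO : Mchan cs (Minv cs O) = O.
  apply: (xgetPex 0 (P := [set X | Mchan cs X = O])%classic).
  by exists ((d%:R + 1) *: O).
have := coef_Mchan (Minv cs O) s; rewrite MO.
have [->|s0] := eqVneq s pauli0.
  by rewrite stab2_00 mul1r coef0 trO mulr0 => <-.
by rewrite stab2_diag // => ->; rewrite mulVKf ?dD1_neq0.
Qed.

(** Expanding the square leaves a double sum weighted by [stab2]; the three sums in the result come
    from the three terms of the numerator in [stab2E]. *)
Lemma avg_sqr O rho (f : L -> C) : \tr O = 0 ->
  (forall s, coef rho s * coef O s = f s) ->
  avgU cs (fun U => (\sum_(b < d) (U *m rho *m dag U) b b *
                        (U *m Minv cs O *m dag U) b b) ^+ 2) =
  (d%:R + 1) / (d%:R ^+ 2 * (d%:R + 2)) *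
  (d%:R * (\sum_s f s ^+ 2) + (\sum_s f s) ^+ 2 + \sum_s \sum_t chi s t * (f s * f t)).
Proof.
move=> trO fE.
(* [stab2E] excludes the trivial label; the tracelessness of [O] gives that label weight zero. *)
have f0 : f pauli0 = 0 by rewrite -fE !coef0 trO mulr0.
transitivity (avgU cs (fun U => ((d%:R + 1) / d%:R) ^+ 2 *
    \sum_s \sum_t ((stab U s)%:R * (stab U t)%:R) * (f s * f t))).
  apply: eq_avgU => U hU; rewrite (diag_sum rho (Minv cs O) hU).
  have -> : \sum_s (stab U s)%:R * (coef rho s * coef (Minv cs O) s) =
     (d%:R + 1) * \sum_s (stab U s)%:R * f s.
    by rewrite mulr_sumr; apply: eq_bigr => s _; rewrite coef_Minv // -fE; ring.
  rewrite mulrA exprMn mulrC [_^-1 * _]mulrC mulrC; congr (_ * _).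
  rewrite expr2 mulr_suml; apply: eq_bigr => s _.
  by rewrite mulr_sumr; apply: eq_bigr => t _; rewrite mulrACA.
rewrite avgUZ avgU_sum.
transitivity (((d%:R + 1) / d%:R) ^+ 2 * \sum_s \sum_t
   ((f s * f t + chi s t * (f s * f t) + (s == t)%:R * (d%:R * (f s * f t)))
     * ((d%:R + 1) * (d%:R + 2))^-1)).
  congr (_ * _); apply: eq_bigr => s _; rewrite avgU_sum; apply: eq_bigr => t _.
  transitivity (stab2 s t * (f s * f t)).
    exact/esym/stab2Mr.
  have [->|s0] := eqVneq s pauli0; first by rewrite f0 !(mul0r, mulr0, addr0).
  have [->|t0] := eqVneq t pauli0; first by rewrite f0 !(mul0r, mulr0, addr0).
  rewrite (stab2E s0 t0) mulrAC; congr (_ * _); ring.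
under eq_bigr do rewrite -mulr_suml !big_split /=.
rewrite -mulr_suml !big_split /=.
have -> : \sum_s \sum_t f s * f t = (\sum_s f s) ^+ 2.
  by rewrite expr2 mulr_suml; apply: eq_bigr => s _; rewrite mulr_sumr.
have -> : \sum_s \sum_t (s == t)%:R * (d%:R * (f s * f t)) = d%:R * \sum_s f s ^+ 2.
  rewrite mulr_sumr; apply: eq_bigr => s _; rewrite (bigD1 s) //= big1 => [|t].
    by rewrite eqxx mul1r addr0.
  by rewrite eq_sym => /negPf->; rewrite mul0r.
have := dD1_neq0; have := dD2_neq0; have := d_neq0 R n => d0 D2 D1.
field; by rewrite d0 D1 D2.
Qed.

End Average.

(** * Real-valued estimates for Pauli coefficients of states *)

Section Variance.
Variables (R : realType) (n : nat).
Local Notation C := (complex R).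
Local Notation L := {ffun 'I_n -> 'I_4}.
Local Notation d := (2 ^ n)%N.
Local Notation P := (@pauli_mx R n).
Local Notation chi := (@comm_sign R n).
Local Notation coef := (@coef R n).
Local Notation toC := (real_complex R).

(** Conjugating [A] by [P s] multiplies its coefficient at [t] by [chi s t]; then Parseval
    applies. *)
Lemma chi_convolution s A B :
  \sum_t chi s t * (coef A t * coef B t) = d%:R * \tr (P s *m A *m P s *m B).
Proof.
rewrite -sum_coef; apply: eq_bigr => t _; rewrite mulrA; congr (_ * _).
rewrite /coef -[_ *m P s *m P t]mulmxA (pauli_swap _ s t) -scalemxAr mxtraceZ; congr (_ * _).
by rewrite [RHS]mxtrace_mulC -!mulmxA (mulmxA (P s) (P s)) pauli_sqr mul1mx mxtrace_mulC.
Qed.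

Lemma coef_real A s : dag A = A -> coef A s = toC (complex.Re (coef A s)).
Proof.
by move=> hA; apply/esym/RRe_real; rewrite CrealE coef_conj.
Qed.

Definition comm_signR (s t : L) : R := complex.Re (chi s t).

Local Notation chiR := comm_signR.

Lemma chiRE s t : chi s t = toC (chiR s t).
Proof. by rewrite /comm_signR; case: (chi_sign R s t) => -> //; rewrite rmorphN. Qed.

Lemma sum_chiR t u : \sum_s chiR s t * chiR s u = d%:R ^+ 2 * (t == u)%:R.
Proof.
apply: (@complexI R); rewrite rmorph_sum rmorphM rmorphXn !rmorph_nat.
rewrite -pauli_add_eq0 -sum_chi; apply: eq_bigr => s _.
by rewrite chiDr !chiRE rmorphM.
Qed.

(* [d^-1 chi] is an orthogonal matrix (Plancherel), hence of norm at most 1. *)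
Lemma chiR_form_le (F : L -> R) :
  \sum_s \sum_t chiR s t * (F s * F t) <= d%:R * \sum_s F s ^+ 2.
Proof.
pose G s := \sum_t chiR s t * F t.
have -> : \sum_s \sum_t chiR s t * (F s * F t) = \sum_s F s * G s.
  by apply: eq_bigr => s _; rewrite mulr_sumr; apply: eq_bigr => t _; rewrite mulrCA.
have sumG2 : \sum_s G s ^+ 2 = d%:R ^+ 2 * \sum_s F s ^+ 2.
  transitivity (\sum_t \sum_u F t * F u * \sum_s chiR s t * chiR s u).
    under eq_bigr do rewrite expr2 mulr_suml.
    rewrite exchange_big; apply: eq_bigr => t _.
    under eq_bigr do rewrite mulr_sumr.
    rewrite exchange_big; apply: eq_bigr => u _.
    by rewrite mulr_sumr; apply: eq_bigr => s _; ring.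
  rewrite mulr_sumr; apply: eq_bigr => t _; rewrite (bigD1 t) //= [X in _ + X]big1 ?addr0 => [|u].
    by rewrite sum_chiR eqxx mulr1 mulrC expr2.
  by rewrite sum_chiR eq_sym => /negPf->; rewrite !mulr0.
(* Since G has norm d times that of F, this square expands to 2 d times the difference of the two
   sides. *)
have : 0 <= \sum_s (G s - d%:R * F s) ^+ 2 by apply: sumr_ge0 => s _; exact: sqr_ge0.
have -> : \sum_s (G s - d%:R * F s) ^+ 2 =
    \sum_s G s ^+ 2 - 2 * d%:R * (\sum_s F s * G s) + d%:R ^+ 2 * \sum_s F s ^+ 2.
  rewrite !mulr_sumr -sumrB -big_split /=; apply: eq_bigr => s _; ring.
rewrite sumG2; set S := \sum_s F s ^+ 2; set T := \sum_s F s * G s => le0.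
have d0 : 0 < d%:R :> R by rewrite ltr0n expn_gt0.
rewrite -subr_ge0 -(pmulr_rge0 _ (_ : 0 < 2 * d%:R)) ?mulr_gt0 //.
by have -> : 2 * d%:R * (d%:R * S - T) = d%:R ^+ 2 * S - 2 * d%:R * T + d%:R ^+ 2 * S by ring.
Qed.

Lemma mxtrace_psd (rho A : 'M[C]_d) :
  (forall v : 'cV[C]_d, 0 <= (dag v *m rho *m v) 0 0) ->
  0 <= \tr (dag A *m rho *m A).
Proof.
move=> rho_ge0; apply: sumr_ge0 => j _.
have -> : (dag A *m rho *m A) j j = (dag (col j A) *m rho *m col j A) 0 0.
  rewrite !mxE; apply: eq_bigr => k _; rewrite !mxE; congr (_ * _).
  by apply: eq_bigr => l _; rewrite !mxE.
exact: rho_ge0.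
Qed.

(** Both 1 + P_s and 1 - P_s satisfy A^2 = 2 A, so positivity of [rho] makes 1 + tr(rho P_s) and 1 -
    tr(rho P_s) nonnegative. *)
Lemma coef_density_le1 rho s : density rho -> complex.Re (coef rho s) ^+ 2 <= 1.
Proof.
move=> [rho_herm rho_ge0 tr1].
have sgn (e : C) : e^* = e -> e * e = 1 -> 0 <= 1 + e * coef rho s.
  move=> econj ee; have := mxtrace_psd (1%:M + e *: P s) rho_ge0.
  rewrite dagD dag1 dagZ dag_pauli econj mxtrace_mulC mulmxA.
  have -> : (1%:M + e *: P s) *m (1%:M + e *: P s) = 2 *: (1%:M + e *: P s).
    rewrite mulmxDl !mulmxDr !mul1mx !mulmx1 -scalemxAl -scalemxAr pauli_sqr.
    by rewrite scalerA ee scale1r scaler_nat mulr2n [e *: _ + _]addrC.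
  rewrite -scalemxAl mxtraceZ pmulr_rge0 ?ltr0n // mulmxDl mul1mx mxtraceD tr1.
  by rewrite -scalemxAl mxtraceZ mxtrace_mulC.
have := sgn 1 (rmorph1 _) (mulr1 _); have := sgn (-1); rewrite rmorphN rmorph1 mulrNN mulr1.
move=> /(_ erefl erefl); rewrite mul1r mulN1r (coef_real s rho_herm).
set r := complex.Re _; rewrite -(rmorph1 toC) -rmorphN -!rmorphD /= !ler0c => h1 h2.
rewrite -subr_ge0; have -> : 1 - r ^+ 2 = (1 - r) * (1 + r) by ring.
exact: mulr_ge0.
Qed.

(** Nonnegativity of the two by two principal minors; summed over all entries it bounds the purity
    tr(rho^2) by (tr rho)^2 without diagonalising [rho]. *)
Lemma density_minor (rho : 'M[C]_d) (i j : 'I_d) : density rho ->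
  rho i j * rho j i <= rho i i * rho j j.
Proof.
move=> [rho_herm rho_ge0 _].
have hconj k l : (rho k l)^* = rho l k by rewrite -{2}rho_herm !mxE.
pose B (u v : 'cV[C]_d) := (dag u *m rho *m v) 0 0.
have BDl u u' v : B (u + u') v = B u v + B u' v by rewrite /B dagD !mulmxDl mxE.
have BDr u v v' : B u (v + v') = B u v + B u v' by rewrite /B mulmxDr mxE.
have BZl a u v : B (a *: u) v = a^* * B u v by rewrite /B dagZ -!scalemxAl mxE.
have BZr a u v : B u (a *: v) = a * B u v by rewrite /B -scalemxAr mxE.
have Bdelta k l : B (delta_mx k 0) (delta_mx l 0) = rho k l.
  by rewrite /B /dag map_delta_mx trmx_delta -rowE -colE !mxE.
have B_ge0 v : 0 <= B v v by exact: rho_ge0.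
have quad a b k l : 0 <= a^* * (a * rho k k) + a^* * (b * rho k l) +
    (b^* * (a * rho l k) + b^* * (b * rho l l)).
  rewrite -!Bdelta; move: (delta_mx k 0) (delta_mx l 0) => u v.
  by have := B_ge0 (a *: u + b *: v); rewrite BDl !BDr !BZl !BZr.
have minor k l : 0 < rho l l -> rho k l * rho l k <= rho k k * rho l l.
  move=> ll_gt0; rewrite -subr_ge0 -(pmulr_rge0 _ ll_gt0).
  (* On this vector the form takes the value [rho l l] times the minor. *)
  have := quad (rho l l) (- rho l k) k l; rewrite rmorphN /= !hconj.
  move: (rho k k) (rho l l) (rho k l) (rho l k) => x y z t.
  have -> : y * (x * y - z * t) =
    y * (y * x) + y * (- t * z) + (- z * (y * t) + - z * (- t * y)) by ring.
  by [].
have diag_ge0 k : 0 <= rho k k.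
  have := quad 1 0 k k; rewrite rmorph1 rmorph0; by rewrite !(mul0r, mulr0, addr0, mul1r).
have := diag_ge0 i; have := diag_ge0 j.
rewrite le0r => /orP[/eqP jj0|jj _]; last exact: minor.
rewrite le0r => /orP[/eqP ii0|ii]; last by rewrite mulrC [leRHS]mulrC; exact: minor.
(* With both diagonal entries zero the form equals -2 |rho_ij|^2, which is therefore nonnegative. *)
have := quad 1 (- rho j i) i j; rewrite rmorph1 rmorphN /= hconj ii0 jj0
  !mulr0 !mul1r add0r addr0.
rewrite [X in X + _]mulNr [X in _ + X]mulNr -opprD oppr_ge0 (mulrC (rho j i)) -mulr2n.
by rewrite pmulrn_lle0.
Qed.

Lemma sum_coef_sqr_le (rho : 'M[C]_d) : density rho ->
  \sum_s complex.Re (coef rho s) ^+ 2 <= d%:R.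
Proof.
move=> hrho; have [rho_herm _ tr1] := hrho; rewrite -lecR.
have -> : toC (\sum_s complex.Re (coef rho s) ^+ 2) = d%:R * \tr (rho *m rho).
  rewrite -sum_coef rmorph_sum; apply: eq_bigr => s _.
  by rewrite rmorphXn /= -coef_real // expr2.
rewrite rmorph_nat -[leRHS]mulr1 ler_wpM2l // -[leRHS](mulr1 1) -{1 2}tr1.
rewrite /mxtrace mulr_suml; apply: ler_sum => i _; rewrite mxE mulr_sumr.
by apply: ler_sum => j _; exact: density_minor.
Qed.

Lemma pure_density (phi : 'cV[C]_d) : pure_state phi -> density (phi *m dag phi).
Proof.
move=> hphi; split; first by rewrite dagM dagK.
  move=> v; rewrite mulmxA -mulmxA -[dag phi *m v]dagK dagM dagK.
  rewrite mxE; apply: sumr_ge0 => k _; rewrite !mxE; exact: mul_conjC_ge0.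
by rewrite mxtrace_mulC hphi mxtrace1.
Qed.

Lemma Xi_coef (phi : 'cV[C]_d) s : Xi phi s = coef (phi *m dag phi) s.
Proof.
by rewrite /Xi /coef -mulmxA [RHS]mxtrace_mulC [in RHS]mulmxA [RHS]mxtrace_mulC trace_mx11.
Qed.

End Variance.

(** * The variance formula for a pure-state observable *)

Section Bounds.
Variables (R : realType) (n : nat).
Local Notation C := (complex R).
Local Notation L := {ffun 'I_n -> 'I_4}.
Local Notation d := (2 ^ n)%N.
Local Notation P := (@pauli_mx R n).
Local Notation chi := (@comm_sign R n).
Local Notation chiR := (@comm_signR R n).
Local Notation coef := (@coef R n).
Local Notation toC := (real_complex R).

Section Shift.
Variable F : L -> C.
Hypothesis F0 : F pauli0 = 1.
Local Notation f := (fun s => F s - (s == pauli0)%:R).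

(** Subtracting 1/d from the projector changes only the coefficient at the trivial label; the lemmas
    on [f] transfer this correction to each sum of [avg_sqr]. *)
Lemma sum_shiftM (g : L -> C) : \sum_s f s * g s = \sum_s F s * g s - g pauli0.
Proof.
transitivity (\sum_s F s * g s - \sum_(u : L) (u == pauli0)%:R * g pauli0); last first.
  by rewrite sum_delta.
rewrite -sumrB; apply: eq_bigr => s _.
rewrite mulrBl; have [->//|_] := eqVneq s pauli0; by rewrite !mul0r.
Qed.

Lemma sum_shift : \sum_s f s = \sum_s F s - 1.
Proof.
have := sum_shiftM (fun=> 1); under eq_bigr do rewrite mulr1.
by under [in X in _ = X - _]eq_bigr do rewrite mulr1.
Qed.

Lemma sum_sqr_shift : \sum_s f s ^+ 2 = \sum_s F s ^+ 2 - 1.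
Proof.
transitivity (\sum_s f s * f s); first by apply: eq_bigr => s _; rewrite expr2.
rewrite sum_shiftM F0 eqxx subrr subr0.
transitivity (\sum_s f s * F s); first by apply: eq_bigr => s _; rewrite mulrC.
by rewrite sum_shiftM F0; congr (_ - _); apply: eq_bigr => s _; rewrite expr2.
Qed.

Lemma sum_chi_shift : \sum_s \sum_u chi s u * (f s * f u) =
  \sum_s \sum_u chi s u * (F s * F u) - 2 * (\sum_s F s) + 1.
Proof.
have chi_sum (g : L -> C) s : \sum_u chi s u * (g s * f u) =
    \sum_u chi s u * (g s * F u) - g s.
  transitivity (\sum_u f u * (chi s u * g s)); first by apply: eq_bigr => u _; ring.
  rewrite sum_shiftM chi0 mul1r; congr (_ - _); by apply: eq_bigr => u _; ring.
transitivity (\sum_s (\sum_u chi s u * (f s * F u) - f s)).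
  by apply: eq_bigr => s _; rewrite (chi_sum f).
rewrite sumrB sum_shift exchange_big /=.
transitivity (\sum_s (\sum_u chi s u * (F s * F u) - F s) - (\sum_s F s - 1)).
  congr (_ - _); apply: eq_bigr => s _; rewrite -(chi_sum F).
  by apply: eq_bigr => u _; rewrite chiC [X in _ * X]mulrC.
by rewrite sumrB; ring.
Qed.

End Shift.

Hypothesis n_gt0 : (0 < n)%N.
Variables (cs : seq 'M[C]_d) (hcs : clifford_transversal cs).
Variables (phi : 'cV[C]_d) (hphi : pure_state phi).
Local Notation Phi := (phi *m dag phi).
Local Notation O := (Phi - d%:R^-1 *: 1%:M).

Lemma mxtrace_pure : \tr Phi = 1.
Proof. by rewrite mxtrace_mulC hphi mxtrace1. Qed.

Lemma mxtrace_O : \tr O = 0.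
Proof.
by rewrite mxtraceD mxtrace_pure raddfN /= mxtraceZ mxtrace1 mulVf ?d_neq0 // subrr.
Qed.

Lemma coef_O s : coef O s = coef Phi s - (s == pauli0)%:R.
Proof.
rewrite /coef mulmxBl raddfB /= -scalemxAl mxtraceZ mul1mx mxtrace_pauli.
by rewrite mulKf ?d_neq0.
Qed.

(** By Parseval [t] is <phi|rho|phi>. The corrections at the trivial label and the subtracted
    squared mean combine into the single term in (1 + t)^2. *)
Lemma variance_expansion rho (F : L -> C) (t := d%:R^-1 * \sum_s F s) :
  \tr rho = 1 -> (forall s, coef rho s * coef Phi s = F s) ->
  avgU cs (fun U => (\sum_(b < d) (U *m rho *m dag U) b b *
                        (U *m Minv cs O *m dag U) b b) ^+ 2) - (\tr (O *m rho)) ^+ 2 =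
  (d%:R + 1) / (d%:R ^+ 2 * (d%:R + 2)) *
    (d%:R * (\sum_s F s ^+ 2) + \sum_s \sum_u chi s u * (F s * F u))
  - (1 + t) ^+ 2 / (d%:R + 2).
Proof.
move=> tr1 FE.
have F0 : F pauli0 = 1 by rewrite -FE !coef0 tr1 mxtrace_pure mulr1.
pose f s := F s - (s == pauli0)%:R.
have fE s : coef rho s * coef O s = f s.
  rewrite coef_O /f -FE; have [->|_] := eqVneq s pauli0; last by rewrite !subr0.
  by rewrite !coef0 tr1 !mul1r.
have trO : \tr (O *m rho) = t - d%:R^-1.
  rewrite mulmxBl raddfB /= -scalemxAl mxtraceZ mul1mx tr1 mulr1; congr (_ - _).
  rewrite mxtrace_mulC; apply: (mulfI (d_neq0 R n)).
  rewrite -sum_coef /t mulVKf ?d_neq0 //; by apply: eq_bigr => s _.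
have sumF : \sum_s F s = d%:R * t by rewrite /t mulVKf ?d_neq0.
rewrite (avg_sqr hcs n_gt0 mxtrace_O fE) trO (sum_shift F) (sum_sqr_shift F0)
  (sum_chi_shift F) sumF.
have := dD1_neq0 R n; have := dD2_neq0 R n; have := d_neq0 R n.
move: (\sum_s F s ^+ 2) (\sum_s _) (t) (d%:R : C) => S2 X T D D0 D2 D1.
field; by rewrite D0 D2.
Qed.

Definition pauli_mean (s : L) : R := complex.Re (Xi phi s).
Local Notation xi := pauli_mean.

Lemma pauli_meanE s : coef Phi s = toC (xi s).
Proof.
rewrite /pauli_mean Xi_coef -coef_real //.
by have [] := pure_density hphi.
Qed.

Lemma pauli_mean0 : xi pauli0 = 1.
Proof. by rewrite /pauli_mean Xi_coef coef0 mxtrace_pure. Qed.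

Lemma Vrho_formula rho (F := fun s => complex.Re (coef rho s) * xi s)
    (t := d%:R^-1 * \sum_s F s) : density rho ->
  Vrho cs O rho =
  (d%:R + 1) / (d%:R ^+ 2 * (d%:R + 2)) *
    (d%:R * (\sum_s F s ^+ 2) + \sum_s \sum_u chiR s u * (F s * F u))
  - (1 + t) ^+ 2 / (d%:R + 2).
Proof.
move=> [rho_herm _ tr1].
have FE s : coef rho s * coef Phi s = toC (F s).
  by rewrite rmorphM /= -coef_real // -pauli_meanE.
rewrite /Vrho (variance_expansion tr1 FE).
have sumE (G : L -> R) : \sum_s toC (G s) = toC (\sum_s G s) by rewrite rmorph_sum.
have -> : \sum_s toC (F s) ^+ 2 = toC (\sum_s F s ^+ 2).
  by rewrite -sumE; apply: eq_bigr => s _; rewrite rmorphXn.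
have -> : \sum_s \sum_u chi s u * (toC (F s) * toC (F u)) =
    toC (\sum_s \sum_u chiR s u * (F s * F u)).
  rewrite -sumE; apply: eq_bigr => s _; rewrite -sumE; apply: eq_bigr => u _.
  by rewrite chiRE !rmorphM.
rewrite sumE -/t; have natE k : k%:R = toC k%:R by rewrite rmorph_nat.
rewrite !natE -(rmorph1 toC) -/t.
by rewrite -!(rmorphD, rmorphM, rmorphXn, fmorphV, rmorphB).
Qed.

End Bounds.

(** * The bound for arbitrary states and the value at the target state *)

Section FinalBounds.
Variables (R : realType) (n : nat) (n_gt0 : (0 < n)%N).
Local Notation C := (complex R).
Local Notation L := {ffun 'I_n -> 'I_4}.
Local Notation d := (2 ^ n)%N.
Local Notation P := (@pauli_mx R n).
Local Notation chi := (@comm_sign R n).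
Local Notation chiR := (@comm_signR R n).
Local Notation coef := (@coef R n).
Local Notation toC := (real_complex R).
Variables (cs : seq 'M[C]_d) (hcs : clifford_transversal cs).
Variables (phi : 'cV[C]_d) (hphi : pure_state phi).
Local Notation Phi := (phi *m dag phi).
Local Notation O := (Phi - d%:R^-1 *: 1%:M).
Local Notation D := (d%:R : R).
Local Notation xi := (pauli_mean phi).

Lemma D_gt0 : 0 < D.
Proof. by rewrite ltr0n expn_gt0. Qed.

(** Here [y] stands for 2^(-M2/2). The term (D + 2)^-1 is kept because it does not depend on [rho]
    and so makes the bound on the supremum strict. *)
Lemma Vrho_le rho (y : R) : 0 < y -> \sum_s xi s ^+ 4 = D * y ^+ 2 ->
  density rho -> Vrho cs O rho <= 2 * y * (D + 1) / (D + 2) - (D + 2)^-1.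
Proof.
move=> y_gt0 sum4 hrho; have [rho_herm rho_ge0 tr1] := hrho; have D0 := D_gt0.
rewrite Vrho_formula //; set r := fun s => complex.Re (coef rho s).
pose F s := r s * xi s.
(* This is the fidelity <phi|rho|phi>; its sign gives (1 + t)^2 >= 1. *)
have t_ge0 : 0 <= D^-1 * \sum_s F s.
  have -> : D^-1 * \sum_s F s = complex.Re ((dag phi *m rho *m phi) 0 0).
    apply: (@complexI R); rewrite RRe_real; last exact: ger0_real (rho_ge0 _).
    rewrite -trace_mx11 mxtrace_mulC mulmxA [RHS]mxtrace_mulC rmorphM /= fmorphV /= rmorph_nat.
    apply: (mulfI (d_neq0 R n)); rewrite mulVKf ?d_neq0 // -sum_coef rmorph_sum.
    by apply: eq_bigr => s _; rewrite (pauli_meanE hphi) (coef_real s rho_herm) -rmorphM.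
  have := rho_ge0 phi; by rewrite lecE => /andP[].
have r4 : \sum_s r s ^+ 4 <= D.
  apply: le_trans (sum_coef_sqr_le hrho); apply: ler_sum => s _.
  rewrite -[leRHS]mulr1 (exprD _ 2 2) ler_wpM2l ?sqr_ge0 //; exact: coef_density_le1.
have F2 : \sum_s F s ^+ 2 <= D * y.
  (* Cauchy-Schwarz as a weighted arithmetic-geometric mean inequality; the weight [y] balances the
     two fourth-moment sums. *)
  have : \sum_s 2 * F s ^+ 2 <= \sum_s (y^-1 * xi s ^+ 4 + y * r s ^+ 4).
    apply: ler_sum => s _; rewrite -subr_ge0.
    have -> : y^-1 * xi s ^+ 4 + y * r s ^+ 4 - 2 * F s ^+ 2 =
        y^-1 * (xi s ^+ 2 - y * r s ^+ 2) ^+ 2.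
      rewrite /F; move: (xi s) (r s) => a b; field; exact: lt0r_neq0.
    by rewrite mulr_ge0 ?sqr_ge0 // invr_ge0 ltW.
  rewrite big_split /= -!mulr_sumr sum4 => le2.
  rewrite -(ler_pM2l (ltr0n R 2)) (le_trans le2) //.
  have -> : 2 * (D * y) = y^-1 * (D * y ^+ 2) + y * D by field; exact: lt0r_neq0.
  by rewrite lerD2l ler_wpM2l // ltW.
have F3 := chiR_form_le F.
rewrite -/(r _); apply: lerB.
  rewrite -[leRHS](_ : (D + 1) / (D ^+ 2 * (D + 2)) * (D * (D * y) + D * (D * y)) = _); last first.
    have Dn0 : D != 0 by exact: lt0r_neq0.
    have D2n0 : D + 2 != 0 by apply: lt0r_neq0; lra.
    by field; rewrite ?Dn0 ?D2n0.
  apply: ler_wpM2l; first by apply: divr_ge0; [lra | apply: mulr_ge0; [exact: sqr_ge0 | lra]].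
  apply: lerD; first by rewrite ler_wpM2l // ltW.
  by apply: le_trans F3 _; rewrite ler_wpM2l // ltW.
rewrite -[leLHS]mul1r; apply: ler_wpM2r; first by rewrite invr_ge0; lra.
by rewrite -[leLHS](expr1n _ 2) ler_sqr ?nnegrE ?addr_ge0 // ?lerDl.
Qed.

Lemma Re_coef_pure s : complex.Re (coef Phi s) = xi s.
Proof. by rewrite /pauli_mean Xi_coef. Qed.

(** Rank one makes the middle factor <phi|A|phi> a scalar. *)
Lemma mxtrace_pure_sqr A : \tr (A *m Phi *m A *m Phi) = \tr (A *m Phi) ^+ 2.
Proof.
have trE : \tr (A *m Phi) = (dag phi *m A *m phi) 0 0.
  by rewrite -trace_mx11 mulmxA mxtrace_mulC mulmxA.
have -> : A *m Phi *m A *m Phi = A *m phi *m (dag phi *m A *m phi) *m dag phi.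
  by rewrite !mulmxA.
by rewrite [dag phi *m A *m phi]mx11_scalar -trE mul_mx_scalar -scalemxAl mxtraceZ -mulmxA.
Qed.

(** The squared Pauli means of a pure state form an eigenvector of the sign matrix for the
    eigenvalue d: [chi_convolution] with both arguments equal to the projector. *)
Lemma chiR_conv_pure s : \sum_u chiR s u * xi u ^+ 2 = D * xi s ^+ 2.
Proof.
have := chi_convolution s Phi Phi; rewrite mxtrace_pure_sqr [\tr (P s *m _)]mxtrace_mulC.
rewrite -/(coef _ _) (pauli_meanE hphi) => conv; apply: (@complexI R).
rewrite rmorphM rmorphXn /= rmorph_nat -conv rmorph_sum; apply: eq_bigr => u _.
by rewrite chiRE (pauli_meanE hphi) expr2 !rmorphM.
Qed.

Lemma sum_xi_sqr : \sum_s xi s ^+ 2 = D.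
Proof.
have := chiR_conv_pure pauli0; rewrite pauli_mean0 // expr1n mulr1 => <-.
by apply: eq_bigr => s _; rewrite /comm_signR chiC chi0 mul1r.
Qed.

(** Now F is [xi ^+ 2] and t = 1. The eigenvector relation makes the double sum equal to d times the
    sum of squares, so the Plancherel bound is attained. *)
Lemma Vrho_pure (x : R) : \sum_s xi s ^+ 4 = D * x ->
  Vrho cs O Phi = (2 * x * (D + 1) - 4) / (D + 2).
Proof.
move=> sum4; have D0 := D_gt0; rewrite Vrho_formula //; last exact: pure_density.
have FE s : complex.Re (coef Phi s) * xi s = xi s ^+ 2 by rewrite Re_coef_pure expr2.
have -> : \sum_s (complex.Re (coef Phi s) * xi s) = D.
  by rewrite -[RHS]sum_xi_sqr; apply: eq_bigr => s _.
have -> : \sum_s (complex.Re (coef Phi s) * xi s) ^+ 2 = D * x.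
  by rewrite -sum4; apply: eq_bigr => s _; rewrite FE -exprM.
have -> : \sum_s \sum_u chiR s u * (complex.Re (coef Phi s) * xi s *
    (complex.Re (coef Phi u) * xi u)) = D * (D * x).
  rewrite -sum4 mulr_sumr; apply: eq_bigr => s _.
  rewrite (exprD _ 2 2) mulrA -chiR_conv_pure mulr_suml.
  by apply: eq_bigr => u _; rewrite !FE; ring.
have Dn0 : D != 0 by exact: lt0r_neq0.
have D2n0 : D + 2 != 0 by apply: lt0r_neq0; lra.
by field; rewrite ?Dn0 ?D2n0.
Qed.

End FinalBounds.

(** * Translation into the stabilizer entropy *)

Lemma powR2_log2 (R : realType) (x : R) : 0 < x -> 2 `^ (log2 x) = x.
Proof.
move=> x_gt0; have ln2 : ln 2 != 0 :> R by apply: lt0r_neq0; rewrite ln_gt0 // ltr1n.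
by rewrite /powR pnatr_eq0 /= /log2 divfK // lnK // posrE.
Qed.

Theorem theorem4 (R : realType) (n : nat) (n_gt0 : (0 < n)%N)
  (cs : seq 'M[complex R]_(2 ^ n)) (hcs : clifford_transversal cs)
  (phi : 'cV[complex R]_(2 ^ n)) (hphi : pure_state phi) :
  let d : R := (2 ^ n)%:R in
  let O : 'M[complex R]_(2 ^ n) := phi *m dag phi - ((2 ^ n)%:R^-1) *: 1%:M in
  Vstar cs O < 2 `^ (1 - M2 phi / 2) * (d + 1) / (d + 2) /\
  Vrho cs O (phi *m dag phi) = (2 `^ (1 - M2 phi) * (d + 1) - 4) / (d + 2) /\
  (2 `^ (1 - M2 phi) * (d + 1) - 4) / (d + 2) < 2 `^ (1 - M2 phi).
Proof.
move=> d O; have d_gt0 : 0 < d by exact: D_gt0.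
have d2_gt0 : 0 < d + 2 by lra.
(* Side condition of [powRD], kept in the context for [//]. *)
have two0 a b : ((a + b : R) == 0) ==> ((2 : R) != 0) by rewrite pnatr_eq0 implybT.
pose x := d^-1 * \sum_s pauli_mean phi s ^+ 4.
(* The trivial label alone contributes 1, so the logarithm in [M2] has a positive argument. *)
have x_gt0 : 0 < x.
  rewrite mulr_gt0 ?invr_gt0 // (bigD1 pauli0) //= pauli_mean0 // expr1n.
  rewrite ltr_pwDl // sumr_ge0 // => s _; rewrite (exprM _ 2 2); exact: sqr_ge0.
have sum4 : \sum_s pauli_mean phi s ^+ 4 = d * x by rewrite /x mulVKf // lt0r_neq0.
have powM2 : 2 `^ (- M2 phi) = x by rewrite /M2 opprK powR2_log2.
pose y := 2 `^ (- M2 phi / 2) : R.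
have y_gt0 : 0 < y by exact: powR_gt0.
have y2 : y ^+ 2 = x by rewrite -powM2 expr2 -powRD // -splitr.
have -> : 2 `^ (1 - M2 phi / 2) = 2 * y by rewrite powRD // powRr1 // -mulNr.
have -> : 2 `^ (1 - M2 phi) = 2 * x by rewrite powRD // powRr1 // powM2.
split; last split; last first.
- rewrite ltr_pdivrMr //; lra.
- exact: Vrho_pure.
(* A supremum preserves only weak inequalities; strictness comes from the uniform slack (d +
   2)^-1. *)
apply: (@le_lt_trans _ _ (2 * y * (d + 1) / (d + 2) - (d + 2)^-1)); last first.
  by rewrite ltrBlDr ltrDl invr_gt0.
apply: ge_sup.
  exists (Vrho cs O (phi *m dag phi)); exists (phi *m dag phi) => //.
  exact: pure_density.
move=> _ [rho hrho <-]; apply: Vrho_le => //; by rewrite y2.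
Qed.
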